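(* Let $X \subset \mathbb{Z}^2$. Let $S$ be a member of a set of minimal bounding curves for $X$. Let $a \in S$ be the vertex of an interior angle, with measure $45^{\circ}$ ($\pi/4$ radians), formed by edges $E_1$ and $E_2$ of $S$. Let $A$ be a freezing set or a cold set for $(X,c_1)$. Then $a \in A$.
   Context: Adjacencies in $\mathbb{Z}^2$: distinct points $(x_1,x_2)$, $(y_1,y_2)$ are $c_2$-adjacent if $|x_i-y_i|\le 1$ for $i=1,2$; they are $c_1$-adjacent if moreover they differ in exactly one coordinate. For $\kappa\in\{c_1,c_2\}$ and $X\subset\mathbb{Z}^2$: a $\kappa$-path of length $k$ is a sequence $x_0,\dots,x_k$ with consecutive points equal or $\kappa$-adjacent; a set is $\kappa$-connected if any two of its points are joined by a $\kappa$-path in it; $d_\kappa(x,y)$ is the minimal length of a $\kappa$-path in $X$ from $x$ to $y$. $f:X\to X$ is in $C(X,\kappa)$ (is $\kappa$-continuous) if $\kappa$-adjacent points have equal or $\kappa$-adjacent images. $A\subset X$ is a freezing set for $(X,\kappa)$ if every $f\in C(X,\kappa)$ with $f|_A=\mathrm{id}_A$ equals $\mathrm{id}_X$. For $(X,\kappa)$ connected, $A\subset X$ is a cold set if every $f\in C(X,\kappa)$ with $f|_A=\mathrm{id}_A$ satisfies $d_\kappa(x,f(x))\le 1$ for all $x\in X$. A $c_2$-closed curve is a $c_2$-path $\{s_i\}_{i=0}^m$ with $s_0=s_m$ and $s_i\ne s_j$ whenever $0<|i-j|<m$. If $S\subset\mathbb{Z}^2$ is a $c_2$-closed curve such that $\mathbb{Z}^2\setminus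 S$ has two $c_1$-components, one finite and the other infinite, these are denoted $Int(S)$ and $Ext(S)$ respectively; then $D=S\cup Int(S)$ is a digital disk and $S$ is a bounding curve of $D$. Let $X\subset\mathbb{Z}^2$ be finite and $c_i$-connected, $i\in\{1,2\}$. A set of bounding curves of $X$ is a set of pairwise disjoint $c_2$-closed curves $S_1,\dots,S_n\subset X$ such that: $X\subset S_1\cup Int(S_1)$; for $j>1$, $D_j=S_j\cup Int(S_j)$ is a digital disk; no two of $S_1\cup Ext(S_1),D_2,\dots,D_n$ are $c_1$-adjacent or $c_2$-adjacent; and $\mathbb{Z}^2\setminus X=Ext(S_1)\cup\bigcup_{j=2}^n Int(S_j)$. A bounding curve of a disk $D$ is minimal if no bounding curve of $D$ has fewer points; a set of bounding curves of $X$ consists of minimal bounding curves if no $S_j$ can be replaced by a closed curve with fewer points so that the result is still a set of bounding curves of $X$. A digital line segment is a ($c_1$- or $c_2$-)connected collinear set of more than one point of $\mathbb{Z}^2$; it is horizontal or vertical (axis-parallel) or has slope $\pm1$ (slanted). The edges (sides) of a bounding curve $S$ are the maximal digital line segments in $S$. If edges $E_1,E_2$ of $S$ satisfy $E_1\cap E_2=\{p\}$, the interior angle at $p$ is the angle formed by $E_1$ and $E_2$ on the side of $S$ on which $X$ lies (i.e. the side of $Int(S)$ when $X$ is a digital disk bounded by $S$, or when $S=S_1$; the side of $Ext(S_j)$ when $S=S_j$, $j>1$); $p$ is its vertex.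
   Formalization: The interior angle at a is required to separate X locally: every c1-neighbour of a outside the 45° angle must lie strictly on the side of S away from X, not on S; without this the claim fails for pinched minimal bounding curves that touch a again from outside the angle. *)

(* Defs.v *)
From mathcomp Require Import all_boot all_order all_algebra.
From mathcomp Require Import boolp classical_sets functions cardinality.

Set Implicit Arguments.
Unset Strict Implicit.
Unset Printing Implicit Defensive.

Import Order.TTheory GRing.Theory Num.Theory.
Local Open Scope classical_set_scope.
Local Open Scope ring_scope.

Definition Z2 : Type := (int * int)%type.

Definition c2 : rel Z2 := fun x y =>
  [&& x != y, `|x.1 - y.1| <= 1 & `|x.2 - y.2| <= 1].

Definition c1 : rel Z2 := fun x y =>
  c2 x y && ((x.1 != y.1) (+) (x.2 != y.2)).

Definition step (k : rel Z2) : rel Z2 := fun x y => (x == y) || k x y.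

(* The path x_0, ..., x_k in X is x :: s with size s = k. *)
Definition kpath (k : rel Z2) (X : set Z2) (x y : Z2)
    (s : seq Z2) : Prop :=
  [/\ [set` x :: s] `<=` X, path (step k) x s & last x s = y].

Definition joined (k : rel Z2) (X : set Z2) (x y : Z2) : Prop :=
  exists s, kpath k X x y s.

Definition kconnected (k : rel Z2) (X : set Z2) : Prop :=
  forall x y, X x -> X y -> joined k X x y.

Definition is_dist (k : rel Z2) (X : set Z2) (x y : Z2)
    (d : nat) : Prop :=
  (exists2 s, kpath k X x y s & size s = d) /\
  (forall s, kpath k X x y s -> (d <= size s)%N).

(* A map X -> X is represented by a map on all of Z^2 sending X to X; its
   values outside X play no role. *)
Definition kcontinuous (k : rel Z2) (X : set Z2)
    (f : Z2 -> Z2) : Prop :=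
  (forall x, X x -> X (f x)) /\
  (forall x y, X x -> X y -> k x y -> step k (f x) (f y)).

Definition freezing_set (k : rel Z2) (X A : set Z2) : Prop :=
  A `<=` X /\
  forall f, kcontinuous k X f -> (forall x, A x -> f x = x) ->
    forall x, X x -> f x = x.

Definition cold_set (k : rel Z2) (X A : set Z2) : Prop :=
  [/\ kconnected k X, A `<=` X &
  forall f, kcontinuous k X f -> (forall x, A x -> f x = x) ->
    forall x, X x -> exists2 d, is_dist k X x (f x) d & (d <= 1)%N].

(* A closed curve {s_i}_{i=0}^m is given by s = [:: s_0; ...; s_(m-1)]; the
   predicate [cycle] adds the closing step from s_(m-1) to s_m = s_0, and the
   condition on indices says that s has no repetition. *)
Definition closed_curve (s : seq Z2) : Prop :=
  [/\ s != [::], cycle (step c2) s & uniq s].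

Definition component (x : Z2) (B : set Z2) : set Z2 :=
  [set y | joined c1 B x y].

(* Z^2 \ s has exactly two c1-components, one finite and one infinite. *)
Definition separating (s : seq Z2) : Prop :=
  let B := ~` [set` s] in
  exists x y, [/\ B x /\ B y, finite_set (component x B),
    infinite_set (component y B) & B = component x B `|` component y B].

(* Under [separating s], Int s and Ext s are the two components above. *)
Definition Int (s : seq Z2) : set Z2 :=
  let B := ~` [set` s] in [set x | B x /\ finite_set (component x B)].

Definition Ext (s : seq Z2) : set Z2 :=
  let B := ~` [set` s] in [set x | B x /\ infinite_set (component x B)].

Section Bounding.
Variables (n : nat) (S : 'I_n.+1 -> seq Z2).

(* The curve S ord0 is the outer one, S_1. The side of S j away from X is
   Ext (S j) for the outer curve and Int (S j) for the others. *)
Definition off_side (j : 'I_n.+1) : set Z2 :=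
  if j == ord0 then Ext (S j) else Int (S j).

(* Since each S j is required to be a separating closed curve, the sets
   D_j = S_j `|` Int S_j are digital disks. *)
Definition bounding_curves (X : set Z2) : Prop :=
  [/\ (forall j, [/\ closed_curve (S j), separating (S j) &
                     [set` S j] `<=` X]),
      (forall i j, i != j -> [set` S i] `&` [set` S j] = set0),
      X `<=` [set` S ord0] `|` Int (S ord0),
      (forall i j, i != j -> forall x y,
         ([set` S i] `|` off_side i) x -> ([set` S j] `|` off_side j) y ->
         ~~ c1 x y && ~~ c2 x y) &
      ~` X = \bigcup_(j in [set: 'I_n.+1]) off_side j].

End Bounding.

Definition replace_curve (n : nat) (S : 'I_n.+1 -> seq Z2)
    (j : 'I_n.+1) (s : seq Z2) : 'I_n.+1 -> seq Z2 :=
  fun i => if i == j then s else S i.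

(* Curves have no repetition, so [size] counts their points. *)
Definition minimal_bounding_curves (n : nat) (S : 'I_n.+1 -> seq Z2)
    (X : set Z2) : Prop :=
  bounding_curves S X /\
  forall j s, bounding_curves (replace_curve S j s) X ->
    (size (S j) <= size s)%N.

Definition collinear (E : set Z2) : Prop :=
  forall x y z, E x -> E y -> E z ->
    (y.1 - x.1) * (z.2 - x.2) = (y.2 - x.2) * (z.1 - x.1).

Definition digital_segment (E : set Z2) : Prop :=
  [/\ kconnected c1 E \/ kconnected c2 E, collinear E &
      exists x y, [/\ E x, E y & x <> y]].

Definition edge (s : seq Z2) (E : set Z2) : Prop :=
  [/\ digital_segment E, E `<=` [set` s] &
      forall F, digital_segment F -> F `<=` [set` s] -> E `<=` F -> F = E].

(* octant k points at the angle of k times 45 degrees, counterclockwise from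
   the positive first axis. *)
Definition octant (k : nat) : Z2 :=
  nth (0, 0) [:: (1, 0); (1, 1); (0, 1); (-1, 1);
                 (-1, 0); (-1, -1); (0, -1); (1, -1)] (k %% 8).

(* The edges E1 and E2 leave their only common point p in the directions
   octant k and octant (k + m), in either order. They bound the closed sector
   of the directions octant (k + i), i <= m, of measure 45 * m degrees. This
   sector is the one on the side of X when, around p, it separates X from the
   off side: a c1-neighbour of p belongs to the off side of the curve exactly
   when it lies outside the sector. Only c1-neighbours are tested because Int
   and Ext are c1-components; a diagonal neighbour of p can be cut off from p
   by the curve. *)
Definition interior_angle (off E1 E2 : set Z2) (p : Z2)
    (degrees : nat) : Prop :=
  E1 `&` E2 = [set p] /\
  exists k m : nat,
    [/\ (0 < m < 8)%N, degrees = (45 * m)%N,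
        (E1 (p + octant k) /\ E2 (p + octant (k + m))) \/
        (E2 (p + octant k) /\ E1 (p + octant (k + m))) &
        forall i, (i < 8)%N -> c1 p (p + octant (k + i)) ->
          (off (p + octant (k + i)) <-> (m < i)%N)].

(* Main.v *)
(** At a 45-degree vertex [a], three of the four [c1]-neighbours of [a] lie off
    [X]; the fourth is the next point of the axis-parallel edge, and it is
    [c1]-adjacent to the next point [r] of the slanted edge.  Hence moving [a]
    to [r] and fixing every other point is [c1]-continuous, although [r] is at
    [c1]-distance more than 1 from [a]. *)

Require Import Defs.
From mathcomp Require Import all_boot all_order all_algebra.
From mathcomp Require Import boolp classical_sets functions cardinality.
Local Open Scope classical_set_scope.

Import GRing.Theory Num.Theory.

Lemma c1_sym (x y : Z2) : c1 x y = c1 y x.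
Proof.
by rewrite /c1 /c2 eq_sym (distrC x.1) (distrC x.2) (eq_sym x.1) (eq_sym x.2).
Qed.

Lemma step_c1_sym (x y : Z2) : step c1 x y = step c1 y x.
Proof. by rewrite /step eq_sym c1_sym. Qed.

Lemma step_c1_translate (p u v : Z2) :
  step c1 (p + u)%R (p + v)%R = step c1 u v.
Proof.
have subDD (b x y : int) : (b + x - (b + y) = x - y)%R.
  by rewrite opprD addrACA subrr add0r.
by rewrite /step /c1 /c2 (inj_eq (addrI p)) /= !(inj_eq (addrI _)) !subDD.
Qed.

Lemma octant_mod (k : nat) : octant (k %% 8) = octant k.
Proof. by rewrite /octant modn_mod. Qed.

(** Going round the ring of eight points about the origin, each move changes one coordinate by one;
    periodicity modulo 8 leaves eight cases. *)
Lemma step_c1_octantS (k : nat) : step c1 (octant k) (octant k.+1).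
Proof.
rewrite -(octant_mod k) -(octant_mod k.+1) -[k.+1]addn1 -modnDml.
by move: (k %% 8) (ltn_pmod k (isT : 0 < 8)); do 8?case=> //.
Qed.

(** Odd indices are the diagonal directions, and parity survives reduction modulo 8. *)
Lemma not_step_c1_octant_odd (k : nat) :
  odd k -> ~~ step c1 (0 : Z2)%R (octant k).
Proof.
rewrite -(octant_mod k) -(@odd_mod k 8) //.
by move: (k %% 8) (ltn_pmod k (isT : 0 < 8)); do 8?case=> //.
Qed.

(** Directions are counted from an arbitrary [k] to match [interior_angle], where [k] is the first
    arm of the sector. *)
Lemma c1_octant (k : nat) (p y : Z2) :
  c1 p y -> exists2 i, i < 8 & y = (p + octant (k + i))%R.
Proof.
move=> pcy.
have [i0 i08 yE] : exists2 i, i < 8 & y = (p + octant i)%R.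
  have yE : y = (p + (y - p))%R by rewrite addrC subrK.
  have : step c1 (0 : Z2)%R (y - p)%R.
    by rewrite -(step_c1_translate p) addr0 -yE /step pcy orbT.
  have : (y - p)%R != 0%R :> Z2.
    by rewrite subr_eq0 eq_sym; case/andP: pcy => /and3P[].
  (* Splitting each coordinate into 0, 1, -1 and larger values leaves only the four axis-parallel
     unit vectors. *)
  move: (y - p)%R yE => [[[|[|?]]|[|?]] [[|[|?]]|[|?]]] -> //= _ _.
  - by exists 2.
  - by exists 6.
  - by exists 0.
  - by exists 4.
(* This is [i0 - k] modulo 8; reducing [k] first keeps the subtraction from truncating. *)
exists ((i0 + (8 - k %% 8)) %% 8); first exact: ltn_pmod.
rewrite yE -(octant_mod (k + _)) modnDmr -modnDml addnCA subnKC.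
  by rewrite modnDr octant_mod.
exact/ltnW/ltn_pmod.
Qed.

(** If [a] were outside [A], the map moving only [a], to [r], would fix [A]; its continuity is at
    stake only for pairs containing [a]. *)
Lemma mem_freezing_or_cold (X A : set Z2) (a r : Z2) :
  X a -> X r -> ~~ step c1 a r ->
  (forall y, X y -> c1 a y -> step c1 y r) ->
  freezing_set c1 X A \/ cold_set c1 X A -> A a.
Proof.
move=> Xa Xr aNr nbr frA; apply: contrapT => NAa.
pose f x := if x == a then r else x.
have fa : f a = r by rewrite /f eqxx.
have fcont : kcontinuous c1 X f.
  split=> [x Xx|x y Xx Xy xy]; first by rewrite /f; case: ifP.
  rewrite /f; case: eqP => [xa|_]; case: eqP => [ya|_].
  - by rewrite /step eqxx.
  - by rewrite step_c1_sym; apply: nbr => //; rewrite -xa.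
  - by apply: nbr => //; rewrite -ya c1_sym.
  - by rewrite /step xy orbT.
have fA x : A x -> f x = x.
  by rewrite /f; case: eqP => // -> /NAa.
case: frA => [[_ /(_ f fcont fA a Xa)]|[_ _ /(_ f fcont fA a Xa)]].
  by rewrite fa => ra; move: aNr; rewrite ra /step eqxx.
(* Coldness yields a path of length at most 1 from [a] to [r], that is, a single step, against
   [aNr]. *)
rewrite fa => -[d [[s [_ sp slast] <-] _]].
case: s sp slast => [_ /= ra|y [|//] /=]; first by move: aNr; rewrite ra /step eqxx.
by rewrite andbT => ay yr; move: aNr; rewrite -yr ay.
Qed.

Theorem proposition5p1 (X : set Z2) (n : nat) (S : 'I_n.+1 -> seq Z2)
    (j : 'I_n.+1) (a : Z2) (E1 E2 A : set Z2) :
  finite_set X ->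
  kconnected c1 X \/ kconnected c2 X ->
  minimal_bounding_curves S X ->
  a \in S j ->
  edge (S j) E1 -> edge (S j) E2 ->
  interior_angle (off_side S j) E1 E2 a 45 ->
  freezing_set c1 X A \/ cold_set c1 X A ->
  A a.
Proof.
move=> _ _ [[curveS _ _ _ XC] _] aS [_ E1S _] [_ E2S _] [_ [k [m]]].
case=> _ degE Edir offE.
have {degE} m1 : m = 1 by apply/eqP; rewrite -(eqn_pmul2l (isT : 0 < 45)) -degE.
move: Edir offE; rewrite {}m1 addn1 => Edir offE.
have [_ _ SX] := curveS j.
have [Xk Xk1] : X (a + octant k)%R /\ X (a + octant k.+1)%R.
  by case: Edir => -[/[dup] ? + /[dup] ? +]; split; apply: SX; auto.
have Noff y : X y -> ~ off_side S j y.
  by move=> Xy oy; have : (~` X) y by [rewrite XC; exists j]; apply.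
(* A neighbour of index above 1 lies strictly outside the sector, hence on the off side and not in
   [X]. *)
have nbr y : X y -> c1 a y -> y = (a + octant k)%R \/ y = (a + octant k.+1)%R.
  move=> + /[dup] ay /(c1_octant k)[i i8 yE]; move: ay; rewrite {}yE => ay Xy.
  case: i i8 ay Xy => [|[|i]] i8 ay Xy; rewrite ?addn0 ?addn1; [by left|by right|].
  by case: (Noff _ Xy); apply/(offE _ i8 ay).
have translate0 v : step c1 a (a + v)%R = step c1 (0 : Z2)%R v.
  by rewrite -{1}[a]addr0 step_c1_translate.
have kk1 : step c1 (a + octant k)%R (a + octant k.+1)%R.
  by rewrite step_c1_translate step_c1_octantS.
have refl x : step c1 x x by rewrite /step eqxx.
have Xa : X a by exact: SX.
(* Exactly one of [k] and [k.+1] is odd; that arm is the slanted one and supplies [r]. *)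
case: (boolP (odd k)) => ok.
- apply: (@mem_freezing_or_cold _ _ _ (a + octant k)%R) => //.
    by rewrite translate0 not_step_c1_octant_odd.
  by move=> y Xy /(nbr _ Xy)[] -> //; rewrite step_c1_sym.
- apply: (@mem_freezing_or_cold _ _ _ (a + octant k.+1)%R) => //.
    by rewrite translate0 not_step_c1_octant_odd.
  by move=> y Xy /(nbr _ Xy)[] ->.
Qed.
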